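(* Let $R=\mathbb{F}_1\times\cdots\times\mathbb{F}_t$ where $\mathbb{F}_j$ is a finite field for all $j=1,\dots,t$, and let $\Sigma^{\mathfrak{C}}=(A,B,C,D)$ be an input/state/output representation of a family of convolutional codes $\mathfrak{C}$ over $R$. Then $\Sigma^{\mathfrak{C}}$ is a reachable linear system over $R$.
   Context: Kernel of a pair: for $R$-linear maps (or matrices over $R[z]$) $f_1:M_1\to N$ and $f_2:M_2\to N$, put $\mathrm{Ker}(f_1\mid f_2):=\{m_2\in M_2 : \exists m_1\in M_1,\ f_1(m_1)+f_2(m_2)=0\}$. Convolutional codes: for $k\le n$, an $(n,k)$ family of convolutional codes over $R$ is a free $R[z]$-submodule $\mathfrak{C}\subset R[z]^n$ of rank $k$ such that $R[z]^n/\mathfrak{C}$ is flat over $R$. For a prime $\mathfrak{p}$ of $R$ with residue field $k(\mathfrak{p})$, $\mathfrak{C}(\mathfrak{p}):=\mathfrak{C}\otimes_R k(\mathfrak{p})$ is then a rank $k$ submodule of $k(\mathfrak{p})[z]^n$; its degree is the highest degree of the $k\times k$ minors of any $n\times k$ matrix over $k(\mathfrak{p})[z]$ whose columns generate $\mathfrak{C}(\mathfrak{p})$. Standing assumption: the degree function $\mathfrak{p}\mapsto\deg\mathfrak{C}(\mathfrak{p})$ on $\mathrm{Spec}(R)$ is constant, with value $\delta$. First order representations: a first order representation of an $(n,k)$ code $\mathfrak{C}$ of degree $\delta$ over $R$ is a triple $(K,L,M)$ with $K,L\in \mathrm{Mat}_{(\delta+n-k)\times\delta}(R)$, $M\in \mathrm{Mat}_{(\delta+n-k)\times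 n}(R)$ and $\mathfrak{C}=\mathrm{Ker}(zK+L\mid M)$. It is minimal if: (1) $K:R^\delta\to R^{\delta+n-k}$ is injective with $R$-flat cokernel; (2) $(K,M):R^{\delta+n}\to R^{\delta+n-k}$ is surjective; (3) $(zK+L,M):R[z]^{\delta+n}\to R[z]^{\delta+n-k}$ is surjective. I/S/O representation: an input/state/output representation of $\mathfrak{C}$ is a quadruple $(A,B,C,D)$ with $A\in \mathrm{Mat}_{\delta\times\delta}(R)$, $B\in \mathrm{Mat}_{\delta\times k}(R)$, $C\in \mathrm{Mat}_{(n-k)\times\delta}(R)$, $D\in \mathrm{Mat}_{(n-k)\times k}(R)$ obtained from a minimal first order representation $(K,L,M)$ of $\mathfrak{C}$ as follows: there are $W\in GL_{\delta+n-k}(R)$ and $P\in GL_n(R)$, with the image of $P$ in each $GL_n(\mathbb{F}_j)$ a permutation matrix (reordering of codeword coordinates), such that $$WK=\begin{pmatrix}-\mathrm{Id}_\delta\\ O\end{pmatrix},\quad WL=\begin{pmatrix}A\\ C\end{pmatrix},\quad WMP=\begin{pmatrix}O & B\\ -\mathrm{Id}_{n-k} & D\end{pmatrix}.$$ A linear system $(A,B,C,D)$ over $R$ with $A$ of size $\delta\times\delta$ is reachable if the controllability matrix $\Phi_\delta(A,B):=(B,AB,\dots,A^{\delta-1}B)$ is surjective (as a map onto $R^\delta$). *)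

(* Defs.v *)
From HB Require Import structures.
From mathcomp Require Import all_boot all_order all_algebra.
From mathcomp Require Import ring_quotient fraction.
From mathcomp Require Import sesquilinear.
From mathcomp Require Import boolp.

Set Implicit Arguments.
Unset Strict Implicit.
Unset Printing Implicit Defensive.

Import GRing.Theory.
Local Open Scope ring_scope.

Section ProductRing.
Variables (t : nat) (F : 'I_t.+1 -> finFieldType).

Definition prod_ring : Type := {dffun forall j, F j}.

HB.instance Definition _ := Choice.on prod_ring.

Definition prod_proj (j : 'I_t.+1) (x : prod_ring) : F j := x j.

Definition prod_zero : prod_ring := [ffun j => 0].
Definition prod_one : prod_ring := [ffun j => 1].
Definition prod_opp (x : prod_ring) : prod_ring := [ffun j => - x j].
Definition prod_add (x y : prod_ring) : prod_ring := [ffun j => x j + y j].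
Definition prod_mul (x y : prod_ring) : prod_ring := [ffun j => x j * y j].

Fact prod_addA : associative prod_add.
Proof. by move=> x y z; apply/ffunP => j; rewrite !ffunE addrA. Qed.
Fact prod_addC : commutative prod_add.
Proof. by move=> x y; apply/ffunP => j; rewrite !ffunE addrC. Qed.
Fact prod_add0 : left_id prod_zero prod_add.
Proof. by move=> x; apply/ffunP => j; rewrite !ffunE add0r. Qed.
Fact prod_addN : left_inverse prod_zero prod_opp prod_add.
Proof. by move=> x; apply/ffunP => j; rewrite !ffunE addNr. Qed.

HB.instance Definition _ :=
  GRing.isZmodule.Build prod_ring prod_addA prod_addC prod_add0 prod_addN.

Fact prod_mulA : associative prod_mul.
Proof. by move=> x y z; apply/ffunP => j; rewrite !ffunE mulrA. Qed.
Fact prod_mulC : commutative prod_mul.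
Proof. by move=> x y; apply/ffunP => j; rewrite !ffunE mulrC. Qed.
Fact prod_mul1 : left_id prod_one prod_mul.
Proof. by move=> x; apply/ffunP => j; rewrite !ffunE mul1r. Qed.
Fact prod_mulD : left_distributive prod_mul prod_add.
Proof. by move=> x y z; apply/ffunP => j; rewrite !ffunE mulrDl. Qed.
Fact prod_one_neq0 : prod_one != 0.
Proof. by apply/eqP => /ffunP/(_ ord0)/eqP; rewrite !ffunE oner_eq0. Qed.

HB.instance Definition _ := GRing.Zmodule_isComNzRing.Build prod_ring
  prod_mulA prod_mulC prod_mul1 prod_mulD prod_one_neq0.

Definition prod_unit (x : prod_ring) := [forall j, x j != 0].
(* The library requires the inverse to be the identity on non-units. *)
Definition prod_inv (x : prod_ring) : prod_ring :=
  if prod_unit x then [ffun j => (x j)^-1] else x.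

Fact prod_mulV : {in prod_unit, left_inverse 1 prod_inv *%R}.
Proof.
move=> x xu; have {xu}ux : prod_unit x := xu.
rewrite /prod_inv ux; apply/ffunP => j.
by rewrite !ffunE mulVf ?(forallP ux).
Qed.
Fact prod_unitP (x y : prod_ring) : y * x = 1 -> prod_unit x.
Proof.
move=> /ffunP yx; apply/forallP => j; apply/eqP => xj0.
by move: (yx j) => /eqP; rewrite !ffunE xj0 mulr0 eq_sym oner_eq0.
Qed.
Fact prod_inv_out : {in [predC prod_unit], prod_inv =1 id}.
Proof. by move=> x xu; rewrite /prod_inv ifN. Qed.

HB.instance Definition _ := GRing.ComNzRing_hasMulInverse.Build prod_ring
  prod_mulV prod_unitP prod_inv_out.

Fact prod_proj_zmod_morphism j : zmod_morphism (prod_proj j).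
Proof. by move=> x y; rewrite /prod_proj !ffunE. Qed.
Fact prod_proj_monoid_morphism j : monoid_morphism (prod_proj j).
Proof. by split=> [|x y]; rewrite /prod_proj !ffunE. Qed.
HB.instance Definition _ j :=
  GRing.isZmodMorphism.Build prod_ring (F j) (prod_proj j)
    (prod_proj_zmod_morphism j).
HB.instance Definition _ j :=
  GRing.isMonoidMorphism.Build prod_ring (F j) (prod_proj j)
    (prod_proj_monoid_morphism j).

End ProductRing.


Section ResidueField.
Variables (R : comNzRingType) (p : prime_idealr R).

(* R / p, with the (classically decidable) structure of an integral domain. *)
Definition residue_dom : Type := {ideal_quot p}.

HB.instance Definition _ := GRing.ComNzRing.on residue_dom.

Definition residue_unit (x : residue_dom) := `[< exists y, y * x = 1 >].
Definition residue_inv (x : residue_dom) : residue_dom :=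
  if pselect (exists y, y * x = 1) is left h then projT1 (cid h) else x.

Fact residue_mulV : {in residue_unit, left_inverse 1 residue_inv *%R}.
Proof.
move=> x /asboolP ux; rewrite /residue_inv.
by case: pselect => [h|//]; case: cid.
Qed.
Fact residue_unitP (x y : residue_dom) : y * x = 1 -> residue_unit x.
Proof. by move=> yx; apply/asboolP; exists y. Qed.
Fact residue_inv_out : {in [predC residue_unit], residue_inv =1 id}.
Proof.
move=> x /negP ux; rewrite /residue_inv.
by case: pselect => [h|//]; case: ux; apply/asboolP.
Qed.
HB.instance Definition _ := GRing.ComNzRing_hasMulInverse.Build residue_dom
  residue_mulV residue_unitP residue_inv_out.

Fact residue_domP : GRing.integral_domain_axiom residue_dom.
Proof. exact: Quotient.rquot_IdomainAxiom. Qed.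
HB.instance Definition _ :=
  GRing.ComUnitRing_isIntegral.Build residue_dom residue_domP.

Definition residue_field : fieldType := {fraction residue_dom}.

Definition residue_proj (a : R) : residue_dom := (\pi_{ideal_quot p} a)%qT.

Definition residue (a : R) : residue_field := FracField.tofrac (residue_proj a).

Fact residue_zmod_morphism : zmod_morphism residue.
Proof.
move=> a b; rewrite /residue /residue_proj -raddfB.
by rewrite -[in RHS](raddfB \pi_{ideal_quot p}%qT).
Qed.
Fact residue_monoid_morphism : monoid_morphism residue.
Proof.
split=> [|a b].
  rewrite -(rmorph1 (@FracField.tofrac residue_dom)).
  by rewrite -(rmorph1 \pi_{ideal_quot p}%qT).
rewrite /residue /residue_proj -rmorphM.
by rewrite -[in RHS](rmorphM \pi_{ideal_quot p}%qT).
Qed.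
HB.instance Definition _ :=
  GRing.isZmodMorphism.Build R residue_field residue residue_zmod_morphism.
HB.instance Definition _ :=
  GRing.isMonoidMorphism.Build R residue_field residue residue_monoid_morphism.

End ResidueField.

Section Flatness.
Variable R : comNzRingType.

(* The element \sum_i x_i (x) m_i of the tensor product of N and M is zero;
   by the universal property of the tensor product, this means that every
   bilinear map sends it to zero. Every tensor is of this form. *)
Definition tensor_null (N M : lmodType R) (s : seq (N * M)) : Prop :=
  forall (P : lmodType R) (b : {bilinear N -> M -> P}),
    \sum_(x <- s) b x.1 x.2 = 0.

(* - (x) M preserves injective linear maps. *)
Definition flat (M : lmodType R) : Prop :=
  forall (N N' : lmodType R) (f : {linear N -> N'}), injective f ->
  forall s : seq (N * M),
    tensor_null [seq (f x.1, x.2) | x <- s] -> tensor_null s.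

(* V / S is flat, where Q is a model of V / S with canonical projection q. *)
Definition flat_quotient (V : lmodType R) (S : V -> Prop) : Prop :=
  exists (Q : lmodType R) (q : {linear V -> Q}),
    [/\ forall y, exists v, q v = y, forall v, q v = 0 <-> S v & flat Q].

End Flatness.

(* Matrices act on column vectors. *)
Section Matrices.
Variable R : comNzRingType.

Definition mx_image m n (A : 'M[R]_(m, n)) (y : 'cV[R]_m) : Prop :=
  exists x, A *m x = y.

Definition mx_surjective m n (A : 'M[R]_(m, n)) : Prop :=
  forall y, mx_image A y.

Definition mx_injective m n (A : 'M[R]_(m, n)) : Prop :=
  injective (fun x : 'cV[R]_n => A *m x).

(* Ker(A | B) *)
Definition ker_pair m n1 n2 (A : 'M[R]_(m, n1)) (B : 'M[R]_(m, n2))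
    (x2 : 'cV[R]_n2) : Prop :=
  exists x1, A *m x1 + B *m x2 = 0.

End Matrices.

Section PolyVectors.
Variables (R : comNzRingType) (n : nat).

(* R[z]^n as an R-module; the library makes it a module over R[z] only. *)
Definition polyvec : Type := 'cV[{poly R}]_n.

HB.instance Definition _ := GRing.Zmodule.on polyvec.

Definition polyvec_scale (a : R) (v : polyvec) : polyvec :=
  a%:P *: (v : 'cV_n).

Fact polyvec_scaleA a b v :
  polyvec_scale a (polyvec_scale b v) = polyvec_scale (a * b) v.
Proof. by rewrite /polyvec_scale scalerA polyCM. Qed.
Fact polyvec_scale1 : left_id 1 polyvec_scale.
Proof. by move=> v; rewrite /polyvec_scale scale1r. Qed.
Fact polyvec_scaleDr : right_distributive polyvec_scale +%R.
Proof. by move=> a u v; rewrite /polyvec_scale scalerDr. Qed.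
Fact polyvec_scaleDl v : {morph polyvec_scale^~ v : a b / a + b}.
Proof. by move=> a b; rewrite /polyvec_scale polyCD scalerDl. Qed.
HB.instance Definition _ := GRing.Zmodule_isLmodule.Build R polyvec
  polyvec_scaleA polyvec_scale1 polyvec_scaleDr polyvec_scaleDl.

End PolyVectors.

Section ConvolutionalCodes.
Variables (R : comNzRingType) (n k : nat).
Implicit Type code : submodClosed 'cV[{poly R}]_n.

Definition free_of_rank code : Prop :=
  exists2 G : 'M[{poly R}]_(n, k),
    mx_injective G & forall v, v \in code <-> mx_image G v.

Definition conv_code_family code : Prop :=
  [/\ (k <= n)%N, free_of_rank code
    & flat_quotient (fun v : polyvec R n => (v : 'cV_n) \in code)].

(* The image of code (x)_R k(p) in k(p)[z]^n; the natural map is injective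
   when R[z]^n / code is flat over R. *)
Definition fiber code (p : prime_idealr R)
    (v : 'cV[{poly residue_field p}]_n) : Prop :=
  exists2 s : seq (residue_field p * 'cV[{poly R}]_n),
    all (fun x => x.2 \in code) s
    & v = \sum_(x <- s) x.1%:P *: map_mx (map_poly (@residue R p)) x.2.

(* A k x k minor is given by its rows f 0 < ... < f (k - 1). *)
Definition max_minor_degree (T : comNzRingType) (G : 'M[{poly T}]_(n, k)) :
    nat :=
  (\max_(f : {ffun 'I_k -> 'I_n} |
         [forall i : 'I_k, forall j : 'I_k, (i < j) ==> (f i < f j)])
     (size (\det (rowsub f G))).-1)%N.

(* Two k-column matrices with the same column module differ by a right factor,
   invertible if the rank is k, so d does not depend on the choice of G. *)
Definition fiber_degree code (p : prime_idealr R) (d : nat) : Prop :=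
  exists2 G : 'M[{poly residue_field p}]_(n, k),
    forall v, fiber code v <-> mx_image G v & max_minor_degree G = d.

Definition constant_degree code (delta : nat) : Prop :=
  forall p : prime_idealr R, fiber_degree code p delta.

End ConvolutionalCodes.

Section FirstOrder.
Variables (R : comNzRingType) (n k delta : nat).
Implicit Types K L : 'M[R]_(delta + (n - k), delta).
Implicit Type M : 'M[R]_(delta + (n - k), n).
Implicit Type code : submodClosed 'cV[{poly R}]_n.

(* zK + L *)
Definition pencil K L : 'M[{poly R}]_(delta + (n - k), delta) :=
  'X *: map_mx polyC K + map_mx polyC L.

Definition first_order_rep code K L M : Prop :=
  forall v, v \in code <-> ker_pair (pencil K L) (map_mx polyC M) v.

Definition minimal_rep K L M : Prop :=
  [/\ mx_injective K /\ flat_quotient (mx_image K),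
      mx_surjective (row_mx K M)
    & mx_surjective (row_mx (pencil K L) (map_mx polyC M))].

End FirstOrder.

Definition iso_rep (t : nat) (F : 'I_t.+1 -> finFieldType) (n k delta : nat)
    (hkn : (k <= n)%N) (code : submodClosed 'cV[{poly prod_ring F}]_n)
    (A : 'M[prod_ring F]_delta) (B : 'M[prod_ring F]_(delta, k))
    (C : 'M[prod_ring F]_(n - k, delta)) (D : 'M[prod_ring F]_(n - k, k)) :
    Prop :=
  exists (K L : 'M[prod_ring F]_(delta + (n - k), delta))
         (M : 'M[prod_ring F]_(delta + (n - k), n)),
    [/\ first_order_rep code K L M, minimal_rep K L M
      & exists (W : 'M[prod_ring F]_(delta + (n - k))) (P : 'M[prod_ring F]_n),
        [/\ W \in unitmx,
            P \in unitmx /\ forall j, is_perm_mx (map_mx (@prod_proj t F j) P),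
            W *m K = col_mx (- 1%:M) 0,
            W *m L = col_mx A C
          & W *m M *m P =
            castmx (erefl, subnK hkn) (block_mx 0 B (- 1%:M) D)]].

Section Reachability.
Variables (R : comNzRingType) (delta k : nat).

(* Phi_delta(A, B) = (B, AB, ..., A^(delta - 1) B) *)
Definition controllability_mx (A : 'M[R]_delta) (B : 'M[R]_(delta, k)) :
    'M[R]_(delta, \sum_(i < delta) k) :=
  \mxrow_(i < delta) (A ^+ i *m B).

Definition reachable (m : nat) (A : 'M[R]_delta) (B : 'M[R]_(delta, k))
    (C : 'M[R]_(m, delta)) (D : 'M[R]_(m, k)) : Prop :=
  mx_surjective (controllability_mx A B).

End Reachability.

(* Main.v *)
Require Import Defs.
From mathcomp Require Import all_boot all_order all_algebra.

Set Implicit Arguments.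
Unset Strict Implicit.
Unset Printing Implicit Defensive.

Import GRing.Theory.
Local Open Scope ring_scope.

(** Multiplying a minimal first order representation by the unit [W] and
    reordering the codeword by the unit [P] does not affect the surjectivity of
    (zK + L | M) over R[z]; reading off the upper [delta] rows of the result,
    where the block facing the identity of M vanishes, one finds that
    (A - z | B) is surjective over R[z].  Reachability then follows over any
    nonzero commutative ring, by a polynomial form of the Hautus test: write a
    constant vector as y = (A - z) u + B v and evaluate both sides at z := A,
    with the powers of A on the left of the vector coefficients.  This kills
    (A - z) u, fixes y, and sends B v to the sum of the A^i B v_i, so that
    y is a combination of the columns of the A^i B, for i unbounded
    ([left_evalXM], [left_evalM], [left_evalC]).  By Cayley-Hamilton the powers
    with i < delta are enough ([horner_mx_span], [left_eval_reachable]). *)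

Section LeftEvaluation.
Variables (R : comNzRingType) (d : nat) (A : 'M[R]_d.+1).

(** If v is the sum of the z^i v_i, this is the sum of the A^i N v_i.
    Expressing it with the ring morphism [horner_mx A] avoids any bound on the
    degrees in [v]; the parameter [N] absorbs the coefficient matrices [A] and
    B of the pencil. *)
Definition left_eval m (N : 'M[R]_(d.+1, m)) (v : 'cV[{poly R}]_m) :
    'cV[R]_d.+1 :=
  \sum_(j < m) horner_mx A (v j 0) *m col j N.

Lemma left_evalD m (N : 'M_(_, m)) : {morph left_eval N : u v / u + v}.
Proof.
move=> u v; rewrite -big_split; apply: eq_bigr => j _ /=.
by rewrite mxE rmorphD mulmxDl.
Qed.

(** With [N] the identity, this and [left_evalM] say that z u and A u have the
    same left evaluation, so that (A - z) u evaluates to zero. *)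
Lemma left_evalXM m (N : 'M_(_, m)) v :
  left_eval N ('X *: v) = left_eval (A *m N) v.
Proof.
apply: eq_bigr => j _; rewrite mxE mulrC rmorphM /= horner_mx_X.
by rewrite -mulmxE !colE !mulmxA.
Qed.

Lemma left_evalM m l (N : 'M_(_, m)) (T : 'M[R]_(m, l)) v :
  left_eval N (map_mx polyC T *m v) = left_eval (N *m T) v.
Proof.
rewrite /left_eval.
under eq_bigr => j _.
  rewrite mxE rmorph_sum mulmx_suml.
  under eq_bigr => i _ do
    rewrite mxE rmorphM /= horner_mx_C -mulmxE mul_scalar_mx -scalemxAl.
  over.
rewrite exchange_big /=; apply: eq_bigr => i _.
have -> : col i (N *m T) = \sum_j T j i *: col j N.
  apply/matrixP => a b; rewrite !mxE summxE.
  by apply: eq_bigr => j _; rewrite !mxE mulrC.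
by rewrite mulmx_sumr; apply: eq_bigr => j _; rewrite scalemxAr.
Qed.

Lemma left_evalC (y : 'cV[R]_d.+1) : left_eval 1%:M (map_mx polyC y) = y.
Proof.
apply/matrixP => a b; rewrite ord1 summxE (bigD1 a) //= big1 => [|j ja].
  rewrite [map_mx _ _ _ _]mxE horner_mx_C mul_scalar_mx !mxE eqxx.
  by rewrite mulr1 addr0.
rewrite [map_mx _ _ _ _]mxE horner_mx_C mul_scalar_mx !mxE.
by rewrite eq_sym (negPf ja) mulr0.
Qed.

(** Cayley-Hamilton: the value at [A] depends only on the remainder modulo the
    characteristic polynomial, which is monic of degree [d.+1]. *)
Lemma horner_mx_span (p : {poly R}) :
  exists c : 'I_d.+1 -> R, horner_mx A p = \sum_i c i *: A ^+ i.
Proof.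
set r := Pdiv.Ring.rmodp p (char_poly A).
have -> : horner_mx A p = horner_mx A r.
  rewrite [p in LHS](Pdiv.RingMonic.rdivp_eq (char_poly_monic A)).
  by rewrite rmorphD rmorphM /= Cayley_Hamilton mulr0 add0r.
exists (fun i => r`_i).
have szr : (size r <= d.+1)%N.
  rewrite -ltnS -(size_char_poly A) Pdiv.Ring.ltn_rmodpN0 //.
  by rewrite monic_neq0 ?char_poly_monic.
rewrite /horner_mx /horner_morph (@horner_coef_wide _ d.+1); last first.
  exact: leq_trans (size_poly _ _) szr.
by apply: eq_bigr => i _; rewrite coef_map /= -mulmxE mul_scalar_mx.
Qed.

Lemma left_eval_reachable m (N : 'M_(_, m)) v :
  mx_image (controllability_mx A N) (left_eval N v).
Proof.
have /fin_all_exists [c hc] j := horner_mx_span (v j 0).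
exists (\mxcol_(i < d.+1) (\col_j c j i)).
rewrite mul_mxrow_mxcol /left_eval.
under [RHS]eq_bigr => j _ do rewrite hc mulmx_suml.
rewrite exchange_big /=; apply: eq_bigr => i _.
apply/matrixP => a b; rewrite !mxE summxE; apply: eq_bigr => j _.
by rewrite -scalemxAl !colE mulmxA -colE !mxE mulrC.
Qed.

End LeftEvaluation.

(** Left evaluation at [A] of y = (A - z) u + B v, for a constant y, leaves on
    the right only the contribution of B v, a combination of the columns of the
    controllability matrix. *)
Lemma pencil_surjective_reachable (R : comNzRingType) d k
    (A : 'M[R]_d) (B : 'M[R]_(d, k)) :
  mx_surjective (row_mx (map_mx polyC A - 'X%:M) (map_mx polyC B)) ->
  mx_surjective (controllability_mx A B).
Proof.
case: d A B => [|d] A B surj y; first by exists 0; apply/matrixP => -[].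
have [w] := surj (map_mx polyC y).
rewrite -[w]vsubmxK mul_row_col mulmxBl mul_scalar_mx.
move=> /(congr1 (left_eval A 1%:M)).
set u := usubmx w; set v := dsubmx w.
have -> : map_mx polyC A *m u - 'X *: u + map_mx polyC B *m v
  = map_mx polyC A *m u + 'X *: (- u) + map_mx polyC B *m v by rewrite scalerN.
rewrite !left_evalD left_evalXM !left_evalM mulmx1 !mul1mx.
rewrite -left_evalD subrr.
have -> : left_eval A A 0 = 0.
  by rewrite /left_eval big1 // => j _; rewrite mxE rmorph0 mul0mx.
rewrite add0r left_evalC => <-.
exact: left_eval_reachable.
Qed.

Lemma mul_castmx_col (R : pzSemiRingType) m n n' p (e : n = n')
    (N : 'M[R]_(m, n)) (v : 'M[R]_(n', p)) :
  castmx (erefl, e) N *m v = N *m castmx (esym e, erefl) v.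
Proof. by case: n' / e v. Qed.

Theorem proposition4p3 (t : nat) (F : 'I_t.+1 -> finFieldType)
    (n k delta : nat) (hkn : (k <= n)%N)
    (code : submodClosed 'cV[{poly prod_ring F}]_n)
    (A : 'M[prod_ring F]_delta) (B : 'M[prod_ring F]_(delta, k))
    (C : 'M[prod_ring F]_(n - k, delta)) (D : 'M[prod_ring F]_(n - k, k)) :
  conv_code_family k code ->
  constant_degree k code delta ->
  iso_rep hkn code A B C D ->
  reachable A B C D.
Proof.
move=> _ _ [K [L [M [_ [_ _ surj] [W [P [uW [uP _] eK eL eM]]]]]]].
apply: pencil_surjective_reachable => y.
(* Multiplying by [W] turns this target into (y, 0); of the resulting identity
   only the upper rows are kept. *)
have [w] := surj (map_mx polyC (invmx W) *m col_mx y 0).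
rewrite -[w]vsubmxK mul_row_col; set u := usubmx w; set v := dsubmx w.
move/(congr1 (mulmx (map_mx polyC W))).
rewrite mulmxDr !mulmxA -(map_mxM _ W (invmx W)) mulmxV // map_mx1 mul1mx.
have -> : map_mx polyC W *m pencil K L
    = col_mx (map_mx polyC A - 'X%:M) (map_mx polyC C).
  rewrite /pencil mulmxDr -scalemxAr -!map_mxM eK eL !map_col_mx.
  rewrite map_mxN map_mx1 map_mx0 scale_col_mx add_col_mx scaler0 add0r.
  by rewrite scalerN scalemx1 addrC.
have -> : map_mx polyC W *m map_mx polyC M *m v
  = block_mx 0 (map_mx polyC B) (- 1%:M) (map_mx polyC D)
    *m castmx (esym (subnK hkn), erefl) (map_mx polyC (invmx P) *m v).
  have eM' : W *m M =
      castmx (erefl, subnK hkn) (block_mx 0 B (- 1%:M) D) *m invmx P.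
    by rewrite -eM mulmxK.
  rewrite -map_mxM eM' map_mxM -mulmxA map_castmx map_block_mx.
  rewrite map_mx0 map_mxN map_mx1; exact: mul_castmx_col.
set v' := castmx _ _ => /(congr1 usubmx).
rewrite -[v']vsubmxK mul_col_mx mul_block_col add_col_mx !col_mxKu mul0mx add0r.
by move=> eq_y; exists (col_mx u (dsubmx v')); rewrite mul_row_col.
Qed.
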